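(* Let $\Sigma$ be a finite alphabet. For every $k \in \mathbb{N}$, every word $w \in \Sigma^*$ and every $w' \in B(w,k)$, \[ C_{\mathrm{LZ77}}(w') \le 3\cdot C_{\mathrm{LZ77}}(w) + 4k. \]
   Context: For a word $w = w_1 w_2 \cdots w_n$ over a finite alphabet $\Sigma$, write $w[i:j] = w_i w_{i+1}\cdots w_j$. The LZ77 factorization of $w$ is the decomposition $w = P_1 P_2 \cdots P_z$ computed greedily from left to right: if the prefix $w[1:m]$ has already been parsed, the next phrase is the shortest non-empty prefix of the remaining suffix $w[m+1:n]$ that does not occur as a (contiguous) substring of $w[1:m]$; if no such prefix exists, the next phrase is the whole remaining suffix $w[m+1:n]$. Then $m$ is increased by the length of the phrase and the process repeats until $m=n$. $C_{\mathrm{LZ77}}(w) = z$ denotes the number of phrases. For $w,w' \in \Sigma^n$, the Hamming distance is $\Delta(w,w') = |\{i : w_i \ne w'_i\}|$, and $B(w,k) = \{w' \in \Sigma^{|w|} : \Delta(w,w') \le k\}$. *)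

(* Defs.v *)
From mathcomp Require Import all_boot.

Set Implicit Arguments.
Unset Strict Implicit.
Unset Printing Implicit Defensive.

Section LZ77.

Variable Sigma : finType.
Implicit Types p s w : seq Sigma.

(* Length of the next phrase when the prefix p is already parsed and s remains:
   the least l in 1..|s| such that s[1:l] is not a contiguous substring of p,
   or |s| if there is none (find then returns |s|, which minn truncates). *)
Definition phrase_len p s : nat :=
  minn (find (fun l => ~~ infix (take l s) p) (iota 1 (size s))).+1 (size s).

Fixpoint lz77_rec (fuel : nat) p s : seq (seq Sigma) :=
  match fuel, s with
  | fuel'.+1, _ :: _ =>
      let l := phrase_len p s in
      take l s :: lz77_rec fuel' (p ++ take l s) (drop l s)
  | _, _ => [::]
  end.

(* Phrases are non-empty, so |s| bounds the number of steps
   (see lz77_from_cons for the fuel-free recursion). *)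
Definition lz77_from p s : seq (seq Sigma) := lz77_rec (size s) p s.

Definition lz77 w : seq (seq Sigma) := lz77_from [::] w.

Definition C_LZ77 w : nat := size (lz77 w).

Definition hamming (n : nat) (w w' : n.-tuple Sigma) : nat :=
  #|[set i : 'I_n | tnth w i != tnth w' i]|.

Definition hamming_ball (n : nat) (w : n.-tuple Sigma) (k : nat) :
    {set n.-tuple Sigma} :=
  [set w' | hamming w w' <= k].

Lemma phrase_len_gt0 p s : s != [::] -> 0 < phrase_len p s.
Proof. by case: s => // x s _; rewrite /phrase_len leq_min. Qed.

Lemma phrase_len_le p s : phrase_len p s <= size s.
Proof. exact: geq_minr. Qed.

Lemma phrase_len_new p s l :
  0 < l <= size s -> ~~ infix (take l s) p ->
  phrase_len p s <= l /\ ~~ infix (take (phrase_len p s) s) p.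
Proof.
move=> /andP[l0 ls] Hl; set a := fun l => ~~ infix (take l s) p.
have Ha : has a (iota 1 (size s)).
  by apply/hasP; exists l; rewrite // mem_iota l0 add1n.
have fs : find a (iota 1 (size s)) < size s.
  by rewrite -[X in _ < X](size_iota 1) -has_find.
rewrite /phrase_len -/a (minn_idPl fs); split; last first.
  by have := nth_find 0 Ha; rewrite nth_iota.
rewrite leqNgt; apply/negP => lt.
have lt' : l.-1 < find a (iota 1 (size s)) by rewrite -ltnS prednK.
have := before_find 0 lt'; rewrite nth_iota ?(ltn_trans lt') //.
by rewrite add1n prednK // /a Hl.
Qed.

Lemma phrase_len_old p s :
  (forall l, 0 < l <= size s -> infix (take l s) p) ->
  phrase_len p s = size s.
Proof.
move=> H; apply/minn_idPr; rewrite hasNfind ?size_iota //.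
apply/hasPn => l; rewrite mem_iota add1n ltnS => /H.
by move->.
Qed.

Lemma lz77_rec_fuel f p s : size s <= f -> lz77_rec f p s = lz77_from p s.
Proof.
rewrite /lz77_from; have: size s <= size s by [].
move: {2 4}(size s) => g; elim: f g s p => [|f IH] [|g] [|x t] p //= tg tf.
have lt : size (drop (phrase_len p (x :: t)) (x :: t)) <= size t.
  rewrite size_drop /= leq_subLR -add1n leq_add2r.
  exact: phrase_len_gt0.
by congr cons; apply: IH; apply: (leq_trans lt).
Qed.

Lemma lz77_from_nil p : lz77_from p [::] = [::].
Proof. by []. Qed.

Lemma lz77_from_cons p s : s != [::] ->
  lz77_from p s = take (phrase_len p s) s
    :: lz77_from (p ++ take (phrase_len p s) s) (drop (phrase_len p s) s).
Proof.
case: s => // x t _; rewrite {1}/lz77_from /= lz77_rec_fuel //.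
rewrite size_drop /= leq_subLR -add1n leq_add2r.
exact: phrase_len_gt0.
Qed.

Lemma lz77_flatten w : flatten (lz77 w) = w.
Proof.
rewrite /lz77; move: [::] => p; have [m] := ubnP (size w).
elim: m w p => // m IH [|x t] p //; rewrite ltnS => lt.
rewrite lz77_from_cons // [flatten _]/= IH ?cat_take_drop //.
apply: leq_trans lt; rewrite size_drop ltn_subrL /= andbT.
exact: phrase_len_gt0.
Qed.

End LZ77.

(* Main.v *)
Require Import Defs.
From mathcomp Require Import all_boot zify.

(** Call a position special if it ends a phrase of [w] or if [w] and [w'] differ
    there (an edit), and call a phrase of [w'] bad if it contains a special
    position, so that there are at most [z + k] bad phrases.  A run of
    consecutive good phrases lies in the copied part of one phrase of [w], hence
    has a source in [w] cut into consecutive intervals [J_1, J_2, ...].  As the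
    phrases of [w'] are fresh, no [J_i] is contained in a factor of [w] that
    already occurs in the parsed part of [w']; in particular each [J_i] contains
    an edit.  Let [q_i] be the last edit in [J_i].  Whenever three consecutive
    phrases are good, merge the classes of [q_i] and [q_(i+1)] in a partition of
    the edits.  Two distinct edits of one class are always spanned, together
    with a later edit, by the source of a single run; freshness of [J_(i+1)]
    then forces [q_i] and [q_(i+1)] into different classes before the merge.
    Hence at most [k] triples of consecutive phrases are good, and the number of
    phrases is at most [3 (z + k) + k]. *)

Set Implicit Arguments.
Unset Strict Implicit.
Unset Printing Implicit Defensive.

(** * Occurrences and phrases in terms of positions *)

Lemma infixP_nth (T : eqType) (x0 : T) (u v : seq T) :
  infix u v ->
  exists2 o, o + size u <= size v &
    forall t, t < size u -> nth x0 u t = nth x0 v (o + t).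
Proof.
move=> /infixP[p [s ->]]; exists (size p).
  by rewrite !size_cat addnA leq_addr.
by move=> t tu; rewrite nth_cat ltnNge leq_addr /= addKn nth_cat tu.
Qed.

Lemma nth_infix (T : eqType) (x0 : T) (u v : seq T) o :
  o + size u <= size v ->
  (forall t, t < size u -> nth x0 u t = nth x0 v (o + t)) -> infix u v.
Proof.
move=> ov uv; suff -> : u = take (size u) (drop o v).
  by apply: (@infix_trans _ (drop o v)); rewrite ?infix_take ?infix_drop.
have us : size u = size (take (size u) (drop o v)).
  by rewrite size_takel // size_drop; lia.
by apply: (eq_from_nth (x0 := x0) us) => t tu; rewrite nth_take // nth_drop uv.
Qed.

Lemma infix_phrase_pred (Sigma : finType) (p s : seq Sigma) :
  infix (take (phrase_len p s).-1 s) p.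
Proof.
have [l0|l0] := posnP (phrase_len p s).-1; first by rewrite l0 take0 infix0s.
have ls := phrase_len_le p s.
apply: contraT => /phrase_len_new; case; first by apply/andP; split; lia.
by move=> /leP; lia.
Qed.

Lemma phrase_source (Sigma : finType) (x0 : Sigma) (p s : seq Sigma) :
  exists2 o, o + (phrase_len p s).-1 <= size p &
    forall t, t < (phrase_len p s).-1 -> nth x0 s t = nth x0 p (o + t).
Proof.
have [o] := infixP_nth x0 (infix_phrase_pred p s).
rewrite size_takel; last exact: leq_trans (leq_pred _) (phrase_len_le p s).
by move=> op src; exists o => // t tl; rewrite -src // nth_take.
Qed.

Lemma phrase_fresh (Sigma : finType) (p s : seq Sigma) :
  phrase_len p s < size s -> ~~ infix (take (phrase_len p s) s) p.
Proof.
move=> ls; apply/negP => old.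
have : exists2 l, 0 < l <= size s & ~~ infix (take l s) p.
  case H : (has (fun l => ~~ infix (take l s) p) (iota 1 (size s))).
    by have /hasP[l] := H; rewrite mem_iota add1n ltnS => ? ?; exists l.
  move/hasPn: H => H; move: ls; rewrite phrase_len_old ?ltnn // => l ls.
  by have := H l; rewrite mem_iota add1n ltnS ls negbK; apply.
by case=> l ll new; have [_ /negP] := phrase_len_new ll new.
Qed.

(* [ls] lists the last positions of the phrases, and [off x] is the distance
   from [x] back to its copy; it is meaningful only outside [ls]. *)
Lemma lz77_sources (Sigma : finType) (x0 : Sigma) (p s : seq Sigma) :
  exists (ls : seq nat) (off : nat -> nat),
  [/\ size ls = size (lz77_from p s),
      0 < size s -> (size p + size s).-1 \in ls &
      forall u v, size p <= u -> u < v -> v <= size p + size s ->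
        (forall x, u <= x < v -> x \notin ls) ->
        [/\ off u <= u, v <= u + off u &
            forall x, u <= x < v -> off x = off u /\
              nth x0 (p ++ s) x = nth x0 (p ++ s) (x - off u)]].
Proof.
have [m] := ubnP (size s); elim: m s p => // m IH s p; rewrite ltnS => sm.
have [->|s0] := eqVneq s [::].
  by exists [::], id; split=> // u v /=; rewrite addn0 => *; exfalso; lia.
have l0 := phrase_len_gt0 p s0; have lle := phrase_len_le p s.
have [o op src] := phrase_source x0 p s; rewrite lz77_from_cons //.
set l := phrase_len p s in l0 lle op src *; clearbody l.
have lt : size (drop l s) < m by rewrite size_drop; lia.
have [ls [off [szls lastls srcls]]] := IH _ (p ++ take l s) lt.
have szp : size (p ++ take l s) = size p + l by rewrite size_cat size_takel.
rewrite szp size_drop in lastls srcls.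
(* Letter [size p + t] is copied from position [o + t], so the distance back is [size p - o]
   throughout the first phrase. *)
exists ((size p + l).-1 :: ls),
  (fun x => if x < size p + l then size p - o else off x).
split; first by rewrite /= szls.
  rewrite inE; case: (ltnP l (size s)) => [lls|sl] _; last by apply/orP; left; lia.
  have -> : (size p + size s).-1 = (size p + l + (size s - l)).-1 by lia.
  by rewrite lastls ?orbT; lia.
move=> u v pu uv vs clean; case: (ltnP u (size p + l)) => ul.
  have vl : v < size p + l.
    rewrite ltnNge; apply/negP => lv.
    have := clean (size p + l).-1; rewrite inE eqxx => H.
    by apply: (notF (H _)); apply/andP; split; lia.
  split; [lia | lia | move=> x uxv].
  have -> : x < size p + l by lia.
  split=> //; rewrite !nth_cat.
  have -> : (x < size p) = false by lia.
  have -> : (x - (size p - o) < size p) = true by lia.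
  rewrite src; last by lia.
  by congr nth; lia.
have [||u' v' w'] := srcls u v ul uv; first by lia.
  by move=> x /clean; rewrite inE negb_or => /andP[].
split=> // x uxv; have -> : (x < size p + l) = false by lia.
by have := w' x uxv; rewrite -catA cat_take_drop.
Qed.

(** The last phrase may be old, cut short by the end of the word, so freshness is claimed for
    [j.+1 < Z] only. *)
Lemma lz77_boundaries (Sigma : finType) (x0 : Sigma) (p s : seq Sigma) :
  let Z := size (lz77_from p s) in
  exists b : nat -> nat,
  [/\ b 0 = size p, b Z = size p + size s,
      forall j, j < Z -> b j < b j.+1 &
      forall j o, j.+1 < Z -> o + (b j.+1 - b j) <= b j ->
        ~ (forall t, t < b j.+1 - b j ->
             nth x0 (p ++ s) (b j + t) = nth x0 (p ++ s) (o + t))].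
Proof.
have [m] := ubnP (size s); elim: m s p => // m IH s p; rewrite ltnS => sm.
have [->|s0] := eqVneq s [::].
  by exists (fun=> size p); split; rewrite ?addn0.
have l0 := phrase_len_gt0 p s0; have lle := phrase_len_le p s.
have := @phrase_fresh _ p s; rewrite lz77_from_cons //.
set l := phrase_len p s in l0 lle * => fresh; clearbody l.
have lt : size (drop l s) < m by rewrite size_drop; lia.
have szp : size (p ++ take l s) = size p + l by rewrite size_cat size_takel.
have := IH _ (p ++ take l s) lt.
rewrite szp size_drop -catA cat_take_drop /=.
set Z := size (lz77_from _ _) => -[b [b0 bZ bS bF]].
exists (fun j => if j is j'.+1 then b j' else size p); split=> //=.
- by rewrite bZ; lia.
- by case=> [_|j]; [rewrite b0; lia | exact: bS].
case=> [|j] o; last exact: bF.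
rewrite b0 ltnS addKn => Z0 op eqs.
have /fresh : l < size s.
  rewrite ltnNge; apply/negP => sl; move: Z0.
  by rewrite /Z drop_oversize.
move=> /negP; apply.
apply: (@nth_infix _ x0 _ _ o); rewrite size_takel // => t tl.
have := eqs t tl; rewrite !nth_cat nth_take //.
have -> : (size p + t < size p) = false by lia.
have -> : (o + t < size p) = true by lia.
by rewrite addKn.
Qed.

(** The label of [q] disappears and no new label arises. *)
Lemma undup_merge_leq (T U : eqType) (lab : T -> U) (s : seq T) q q' :
  q \in s -> q' \in s -> lab q != lab q' ->
  size (undup [seq if lab x == lab q then lab q' else lab x | x <- s])
    < size (undup (map lab s)).
Proof.
move=> qs q's neq.
have qm : lab q \in undup (map lab s) by rewrite mem_undup map_f.
rewrite (perm_size (perm_to_rem qm)) ltnS; apply: uniq_leq_size (undup_uniq _) _ => y.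
rewrite mem_undup (mem_rem_uniq _ (undup_uniq _)) inE /= mem_undup.
case/mapP=> x xs ->; case: ifPn => [_|->]; last by rewrite map_f.
by rewrite eq_sym neq map_f.
Qed.

Lemma leq_sum_shift (f : nat -> nat) m : f m = 0 ->
  \sum_(0 <= j < m) f j.+1 <= \sum_(0 <= j < m) f j.
Proof.
move=> fm; apply: leq_trans (leq_addl (f 0) _) _.
by rewrite -big_nat_recl // big_nat_recr //= fm addn0.
Qed.

(** * Runs of good phrases and their sources *)

Section PhraseCount.

Variables (T : eqType) (W W' : nat -> T) (n Z : nat) (ls ed : seq nat).
Variables (off b : nat -> nat).

Definition clean u v := forall x, u <= x < v -> x \notin ls ++ ed.

Hypothesis agree : forall x, x < n -> x \notin ed -> W x = W' x.
Hypothesis last_special : 0 < n -> n.-1 \in ls.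
Hypothesis source : forall u v, u < v -> v <= n -> clean u v ->
  [/\ off u <= u, v <= u + off u &
      forall x, u <= x < v -> off x = off u /\ W x = W (x - off u)].
Hypothesis bZ : b Z = n.
Hypothesis b_lt : forall j, j < Z -> b j < b j.+1.
Hypothesis b_fresh : forall j o, j.+1 < Z -> o + (b j.+1 - b j) <= b j ->
  ~ (forall t, t < b j.+1 - b j -> W' (b j + t) = W' (o + t)).

Definition bad j := (j < Z) && has (fun x => b j <= x < b j.+1) (ls ++ ed).

Definition avail m a a' := exists2 o, o + (a' - a) <= m &
  forall t, t < a' - a -> W' (o + t) = W (a + t).

(** The later edit forces an interval covering the last edit of some [J_i] to reach past the end of
    [J_i]. *)
Definition covers a a' x := (a <= x) && has (fun y => x < y < a') ed.

Lemma b_mono i j : i <= j -> j <= Z -> b i <= b j.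
Proof.
elim: j => [|j IH]; first by rewrite leqn0 => /eqP->.
rewrite leq_eqVlt => /orP[/eqP-> //|]; rewrite ltnS => ij jZ.
by apply: leq_trans (IH ij (ltnW jZ)) (ltnW (b_lt jZ)).
Qed.

Lemma good_clean j : j < Z -> ~~ bad j -> clean (b j) (b j.+1).
Proof.
rewrite /bad => -> /hasPn H x xb; apply/negP => /H; by rewrite xb.
Qed.

Lemma clean_cat u v v' : clean u v -> clean v v' -> clean u v'.
Proof.
by move=> c1 c2 x /andP[ux xv]; case: (ltnP x v) => ?; [apply: c1 | apply: c2];
  apply/andP.
Qed.

Lemma bad_last : 0 < Z -> bad Z.-1.
Proof.
move=> Z0; rewrite /bad; apply/andP; split; first by lia.
apply/hasP; exists n.-1.
  rewrite mem_cat last_special // -bZ -(prednK Z0).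
  by apply: leq_trans (b_lt _); lia.
have := @b_lt Z.-1; rewrite prednK // bZ; lia.
Qed.

Lemma avail_leq m m' a a' : m <= m' -> avail m a a' -> avail m' a a'.
Proof. by move=> mm [o om H]; exists o => //; apply: leq_trans mm. Qed.

(** [w'] agrees with [w] on a clean run, and the run copies its source, so parsing the run makes its
    source available. *)
Lemma avail_clean u v : u < v -> v <= n -> clean u v ->
  avail v (u - off u) (v - off u).
Proof.
move=> uv vn c; have [ou vu src] := source uv vn c.
exists u; first by lia.
move=> t tv; have xi : u <= u + t < v by lia.
have [_ e] := src _ xi.
rewrite -agree; [| lia |]; last first.
  by have := c _ xi; rewrite mem_cat negb_or => /andP[].
by rewrite e; congr W; lia.
Qed.

(** Phrase [j] of [w'] spells the factor of [w] on [J_j], so an available interval containing [J_j]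
    would contradict freshness; the exempt last phrase is bad. *)
Lemma source_not_avail j u a a' : j < Z -> ~~ bad j -> u <= b j ->
  clean u (b j.+1) -> avail (b j) a a' ->
  a <= b j - off u -> b j.+1 - off u <= a' -> False.
Proof.
move=> jZ gj uj c [o om eqs] aj ja.
have jl := b_lt jZ; have jn : b j.+1 <= n by rewrite -bZ; apply: b_mono.
have ul : u < b j.+1 by lia.
have [ou vu src] := source ul jn c.
have jZ' : j.+1 < Z.
  rewrite ltn_neqAle jZ andbT; apply/eqP => e; move: gj.
  by rewrite (_ : j = Z.-1) ?bad_last //; lia.
apply: (@b_fresh j (o + (b j - off u - a)) jZ'); first by lia.
move=> t tj; have xi : u <= b j + t < b j.+1 by lia.
have [_ e] := src _ xi.
rewrite -agree; [| lia |]; last first.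
  by have := c _ xi; rewrite mem_cat negb_or => /andP[].
rewrite e -addnA eqs; last by lia.
by congr W; lia.
Qed.

(** Without an edit, [J_j] would occur unchanged in [w'], and before [b j], as a source ends no
    later than its run starts. *)
Lemma source_last_edit j u : j < Z -> ~~ bad j -> u <= b j ->
  clean u (b j.+1) ->
  exists q, [/\ q \in ed, b j - off u <= q < b j.+1 - off u &
    forall y, y \in ed -> y < b j.+1 - off u -> y <= q].
Proof.
move=> jZ gj uj c.
have jl := b_lt jZ; have jn : b j.+1 <= n by rewrite -bZ; apply: b_mono.
have ul : u < b j.+1 by lia.
have [ou vu src] := source ul jn c.
pose P x := (x \in ed) && (b j - off u <= x < b j.+1 - off u).
have exP : exists x, P x.
  case H : (has (fun x => b j - off u <= x < b j.+1 - off u) ed).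
    by have /hasP[x xe xi] := H; exists x; rewrite /P xe.
  exfalso; apply: (source_not_avail jZ gj uj c _ (leqnn _) (leqnn _)).
  exists (b j - off u); first by lia.
  move=> t tj; apply/esym/agree; first by lia.
  apply/negP => te; move/hasPn: H => /(_ _ te); lia.
have ubP x : P x -> x <= b j.+1 by rewrite /P; lia.
case: (ex_maxnP exP ubP) => q /andP[qe qi] qmax.
exists q; split=> // y ye yj; case: (ltnP y (b j - off u)) => yb; first by lia.
by apply: qmax; rewrite /P ye yb.
Qed.

(** * Links between edits and the merging of classes *)

Definition extra i := [&& i.+2 < Z, ~~ bad i, ~~ bad i.+1 & ~~ bad i.+2].

Definition current i a a' := exists u,
  [/\ u <= b i, clean u (b i.+2), a = u - off u & a' = b i.+2 - off u].

(* A run seen before phrase i.+2 either is still in progress or, if phrases i and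
   i.+1 are good, is complete before phrase i, so that freshness of phrases i and
   i.+1 applies to it. *)
Definition linked i x y := exists a a',
  [/\ covers a a' x, covers a a' y &
      [\/ avail (b i) a a', bad i.+1 /\ avail (b i.+1) a a' | current i a a']].

Lemma coversW a a' c c' x : c <= a -> a' <= c' -> covers a a' x -> covers c c' x.
Proof.
move=> ca ac /andP[ax /hasP[y ye yi]]; apply/andP; split; first by lia.
by apply/hasP; exists y => //; lia.
Qed.

Lemma covers_edit a a' x y : y \in ed -> a <= x -> x < y -> y < a' -> covers a a' x.
Proof.
by move=> ye ax xy ya; rewrite /covers ax; apply/hasP; exists y; rewrite // xy.
Qed.

(** If phrase [i.+2] is bad, a run in progress ends and its copy makes the source available;
    otherwise the source grows by one phrase. *)
Lemma linkedS i x y : i.+2 < Z -> linked i x y -> linked i.+1 x y.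
Proof.
move=> iZ [a [a' [cx cy h]]].
have m1 : b i <= b i.+1 by apply: b_mono; lia.
case: h => [h|[_ h]|[u [ub c ea ea']]].
- by exists a, a'; split=> //; apply: Or31; apply: avail_leq h.
- by exists a, a'; split=> //; apply: Or31.
have m2 : b i.+2 < b i.+3 by apply: b_lt.
have m3 : b i.+1 < b i.+2 by apply: b_lt; lia.
case: (boolP (bad i.+2)) => bi.
  exists a, a'; split=> //; apply: Or32; split=> //.
  rewrite ea ea'; apply: avail_clean => //; first by lia.
  by rewrite -bZ; apply: b_mono; lia.
exists a, (b i.+3 - off u); split.
- by apply: coversW cx; lia.
- by apply: coversW cy; lia.
apply: Or33; exists u; split=> //; first by lia.
exact: clean_cat c (good_clean iZ bi).
Qed.

(** The third good phrase supplies an edit after [q'], so the source of the prolonged run covers [q]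
    and [q']; freshness confines both classes to it. *)
Lemma merge_step i (lab : nat -> nat) : extra i ->
  (forall x y, x \in ed -> y \in ed -> x != y -> lab x = lab y -> linked i x y) ->
  exists q q', [/\ q \in ed, q' \in ed, lab q != lab q' &
    forall x y, x \in ed -> y \in ed -> lab x = lab q -> lab y = lab q' ->
      linked i.+1 x y /\ linked i.+1 y x].
Proof.
case/and4P=> iZ g0 g1 g2 inv.
have iZ0 : i < Z by lia. have iZ1 : i.+1 < Z by lia.
have m0 := b_lt iZ0; have m1 := b_lt iZ1; have m2 := b_lt iZ.
have c0 := good_clean iZ0 g0.
have c1 := clean_cat c0 (good_clean iZ1 g1).
have c2 := clean_cat c1 (good_clean iZ g2).
have n3 : b i.+3 <= n by rewrite -bZ; apply: b_mono.
have lei : b i <= b i.+1 by lia. have lei2 : b i <= b i.+2 by lia.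
have lt03 : b i < b i.+3 by lia.
have [od dd _] := source lt03 n3 c2.
have cur_off u : u <= b i -> clean u (b i.+2) -> off u = off (b i).
  move=> ub c.
  have [|||_ _ /(_ (b i))[|-> //]] := @source u (b i.+2); rewrite //; lia.
(* Runs in progress share the offset at [b i], so one translation [A] serves them all and [J_i] is
   [[A (b i), A (b i.+1))]. *)
have [A AE] : exists A, forall x, A x = x - off (b i).
  by exists (fun x => x - off (b i)).
have A01 : A (b i) < A (b i.+1) by rewrite !AE; lia.
have A12 : A (b i.+1) < A (b i.+2) by rewrite !AE; lia.
have A23 : A (b i.+2) < A (b i.+3) by rewrite !AE; lia.
have A_mono u v : u <= v -> A u <= A v by rewrite !AE; apply: leq_sub2r.
have [q [qe /andP[qi1 qi2] qmax]] := source_last_edit iZ0 g0 (leqnn _) c0.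
have [q' [q'e /andP[q'i1 q'i2] q'max]] := source_last_edit iZ1 g1 lei c1.
have [r [re /andP[ri1 ri2] _]] := source_last_edit iZ g2 lei2 c2.
have F0 := source_not_avail iZ0 g0 (leqnn _) c0.
have F1 := source_not_avail iZ1 g1 lei c1.
have F2 := source_not_avail iZ g2 lei2 c2.
rewrite -!AE in qi1 qi2 q'i1 q'i2 ri1 ri2.
(* Freshness contraposed: an available interval reaching the right end of [J_i] or [J_(i+1)] starts
   after its left end; one starting by the left end of [J_(i+2)] misses its right end. *)
have {}F0 a a' : avail (b i) a a' -> A (b i.+1) <= a' -> A (b i) < a.
  by rewrite !AE ltnNge => av ra; apply/negP => la; apply: F0 av la ra.
have {}F1 a a' : avail (b i) a a' -> A (b i.+2) <= a' -> A (b i.+1) < a.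
  rewrite !AE ltnNge => av ra; apply/negP => la.
  exact: F1 (avail_leq lei av) la ra.
have {}F2 a a' : avail (b i) a a' -> a <= A (b i.+2) -> a' < A (b i.+3).
  rewrite !AE ltnNge => av la; apply/negP => ra.
  exact: F2 (avail_leq lei2 av) la ra.
have after_q y : y \in ed -> q < y -> A (b i.+1) <= y.
  move=> ye; rewrite [A _ <= _]leqNgt AE; apply: contraTN => /(qmax _ ye).
  by rewrite leqNgt.
have after_q' y : y \in ed -> q' < y -> A (b i.+2) <= y.
  move=> ye; rewrite [A _ <= _]leqNgt AE; apply: contraTN => /(q'max _ ye).
  by rewrite leqNgt.
have qq' : q < q' := leq_trans qi2 q'i1.
have q'r : q' < r := leq_trans q'i2 ri1.
have curE a a' : current i a a' -> exists u,
    [/\ u <= b i, clean u (b i.+2), off u = off (b i),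
        a = A u & a' = A (b i.+2)].
  case=> u [ub c -> ->]; exists u; have ou := cur_off u ub c.
  by rewrite !AE ou.
(* The source in progress stops at the end of [J_(i+1)], whose last edit is [q'], so it holds no
   edit after [q']. *)
have curN a a' : current i a a' -> covers a a' q' -> False.
  case/curE=> u [_ _ _ _ ->].
  by case/andP=> _ /hasP[y ye /andP[/(after_q' _ ye) yl]]; rewrite ltnNge yl.
(* [F0] and [F2] squeeze an available interval covering [q] between [A (b i)] and [A (b i.+3)]. *)
have classq x : x \in ed -> lab x = lab q -> exists u,
    [/\ u <= b i, clean u (b i.+3), off u = off (b i) &
        covers (A u) (A (b i.+3)) x].
  move=> xe labx; have [->|xq] := eqVneq x q.
    exists (b i); split=> //.
    exact: (covers_edit re qi1 (ltn_trans qq' q'r) ri2).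
  have [a [a' [cx cq h]]] := inv _ _ xe qe xq labx.
  case/andP: (cq) => aq /hasP[z ze /andP[/(after_q _ ze) zl zr]].
  case: h => [av|[]|]; [|by rewrite (negbTE g1)|].
    exists (b i); split=> //; apply: coversW cx.
      exact: ltnW (F0 _ _ av (leq_trans zl (ltnW zr))).
    exact: ltnW (F2 _ _ av (leq_trans aq (ltnW (ltn_trans qi2 A12)))).
  case/curE=> u [ub c ou ea ea'].
  exists u; split=> //; first exact: clean_cat c (good_clean iZ g2).
  by apply: coversW cx; rewrite ?ea ?ea' ?(ltnW A23).
have classq' y : y \in ed -> lab y = lab q' ->
    covers (A (b i)) (A (b i.+3)) y.
  move=> ye laby; have [->|yq] := eqVneq y q'.
    exact: (covers_edit re (leq_trans qi1 (ltnW qq')) q'r ri2).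
  have [a [a' [cy cq h]]] := inv _ _ ye q'e yq laby.
  case/andP: (cq) => aq /hasP[z ze /andP[/(after_q' _ ze) zl zr]].
  case: h => [av|[]|/curN]; [|by rewrite (negbTE g1)|by case].
  apply: coversW cy; last first.
    exact: ltnW (F2 _ _ av (leq_trans aq (ltnW q'i2))).
  exact: ltnW (ltn_trans A01 (F1 _ _ av (leq_trans zl (ltnW zr)))).
exists q, q'; split=> //.
  (* In a common class, an available interval covering both would reach the end of [J_(i+1)], so by
     [F1] start after [A (b i.+1)], which exceeds [q]. *)
  apply/eqP => labqq.
  have qq : q != q' by rewrite neq_ltn qq'.
  have [a [a' [cq cq' h]]] := inv _ _ qe q'e qq labqq.
  case: h => [av|[]|/curN]; [|by rewrite (negbTE g1)|by apply].
  case/andP: cq => aq _.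
  case/andP: cq' => _ /hasP[z ze /andP[/(after_q' _ ze) zl zr]].
  have A1a := F1 _ _ av (leq_trans zl (ltnW zr)).
  by have := ltn_trans (leq_trans A1a aq) qi2; rewrite ltnn.
move=> x y xe ye labx laby.
have [u [ub c ou cx]] := classq x xe labx.
have cy : covers (A u) (A (b i.+3)) y.
  exact: coversW (A_mono _ _ ub) (leqnn _) (classq' y ye laby).
have cur : current i.+1 (A u) (A (b i.+3)).
  by exists u; rewrite ou !AE; split=> //; apply: leq_trans ub lei.
by split; exists (A u), (A (b i.+3)); split=> //; apply: Or33.
Qed.

(** * Counting the phrases *)

(** Starting from singleton classes, each extra index costs a merge and thus a class. *)
Lemma extra_labelling i : i.+2 <= Z -> exists lab : nat -> nat,
  \sum_(0 <= j < i) extra j + size (undup (map lab ed)) <= size ed /\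
  forall x y, x \in ed -> y \in ed -> x != y -> lab x = lab y -> linked i x y.
Proof.
elim: i => [|i IH] iZ.
  exists id; split; last by move=> x y _ _ /eqP.
  by rewrite big_geq // map_id size_undup.
have [lab [cnt inv]] := IH (ltnW iZ); rewrite big_nat_recr //=.
case: (boolP (extra i)) => ex; last first.
  exists lab; split; first by rewrite addn0.
  by move=> x y xe ye xy /(inv x y xe ye xy); apply: linkedS.
have [q [q' [qe q'e neq mrg]]] := merge_step ex inv.
exists (fun x => if lab x == lab q then lab q' else lab x); split.
  rewrite -addnA add1n; apply: leq_trans cnt; rewrite leq_add2l.
  exact: undup_merge_leq.
move=> x y xe ye xy.
case: eqP => [lx|lx]; case: eqP => [ly|ly] e.
- by apply: (linkedS iZ); apply: inv => //; rewrite lx ly.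
- by have [] := mrg x y xe ye lx (esym e).
- by have [] := mrg y x ye xe ly e.
by apply: (linkedS iZ); apply: inv.
Qed.

Lemma sum_extra_leq : \sum_(0 <= j < Z) extra j <= size ed.
Proof.
case: (ltnP Z 2) => Z2.
  by rewrite big_nat big1 // => j jZ; rewrite /extra; case: ltnP => //; lia.
have [lab [cnt _]] := @extra_labelling Z.-2 ltac:(lia).
rewrite (@big_cat_nat _ _ _ Z.-2) //=; last by lia.
rewrite [X in _ + X]big_nat [X in _ + X]big1 => [|j jZ]; first by lia.
by rewrite /extra; case: ltnP => //; lia.
Qed.

(** Phrases are disjoint, so each bad one uses up its own special position. *)
Lemma sum_bad_leq : \sum_(0 <= j < Z) bad j <= size (ls ++ ed).
Proof.
suff H m : m <= Z -> \sum_(0 <= j < m) bad j <= count (fun x => x < b m) (ls ++ ed).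
  by apply: leq_trans (H Z (leqnn _)) (count_size _ _).
elim: m => [|m IH] mZ; first by rewrite big_geq.
rewrite big_nat_recr //=; have ml := b_lt mZ.
have -> : count (fun x => x < b m.+1) (ls ++ ed) =
    count (fun x => x < b m) (ls ++ ed) +
    count (fun x => b m <= x < b m.+1) (ls ++ ed).
  by elim: (ls ++ ed) => //= x s ->; lia.
apply: leq_add (IH (ltnW mZ)) _.
by rewrite /bad mZ /= has_count; case: (count _ _).
Qed.

(** Each index is extra or begins a window of three phrases with a bad one; near the end the last
    phrase serves. *)
Lemma phrases_leq : Z <= 3 * (size ls + size ed) + size ed.
Proof.
have E := sum_extra_leq; have B := sum_bad_leq; rewrite size_cat in B.
have S1 : \sum_(0 <= j < Z) bad j.+1 <= \sum_(0 <= j < Z) bad j.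
  by apply: (leq_sum_shift (f := fun j => bad j)); rewrite /bad ltnn.
have S2 : \sum_(0 <= j < Z) bad j.+2 <= \sum_(0 <= j < Z) bad j.+1.
  apply: (leq_sum_shift (f := fun j => bad j.+1)).
  by rewrite /bad ltnNge leqnSn.
have : \sum_(0 <= j < Z) 1 <= \sum_(0 <= j < Z) (bad j + bad j.+1 + bad j.+2 + extra j).
  rewrite big_nat [leqRHS]big_nat; apply: leq_sum => j /andP[_ jZ].
  rewrite /extra.
  case: (boolP (bad j)) => //= g0; case: (boolP (bad j.+1)) => //= g1.
  case: (boolP (bad j.+2)) => //= g2; rewrite !andbT.
  case: ltnP => // Zj; have := bad_last (leq_ltn_trans (leq0n _) jZ).
  have [->|->] : Z.-1 = j \/ Z.-1 = j.+1 by lia.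
  - by rewrite (negbTE g0).
  - by rewrite (negbTE g1).
rewrite sum_nat_const_nat !big_split /=; lia.
Qed.

End PhraseCount.

Theorem theorem1 (Sigma : finType) (k n : nat) (w w' : n.-tuple Sigma) :
  w' \in hamming_ball w k -> C_LZ77 w' <= 3 * C_LZ77 w + 4 * k.
Proof.
rewrite inE => hk; case: (posnP n) => [n0|npos].
  by move: w w' hk; rewrite n0 => w w' _; rewrite (tuple0 w').
(* This letter is a default for [nth]; the empty word was settled apart. *)
have x0 : Sigma := tnth w (Ordinal npos).
have [ls [off [szls lastls src]]] := lz77_sources x0 [::] w.
have [b [_ bZ b_lt b_fresh]] := lz77_boundaries x0 [::] w'.
pose ed := [seq val i | i <- enum [set i : 'I_n | tnth w i != tnth w' i]].
have szed : size ed = hamming w w' by rewrite size_map -cardE.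
rewrite /= !size_tuple !add0n in lastls bZ src.
have agree x : x < n -> x \notin ed -> nth x0 w x = nth x0 w' x.
  move=> xn xe; apply/eqP; apply: contraR xe => neq.
  apply/mapP; exists (Ordinal xn) => //.
  by rewrite mem_enum inE !(tnth_nth x0).
have := phrases_leq agree lastls _ bZ b_lt b_fresh.
rewrite -/(C_LZ77 w') szed szls -/(C_LZ77 w) => count_phrases.
apply: leq_trans (count_phrases _ _) _; last by rewrite /C_LZ77 /lz77; lia.
move=> u v uv vn c; apply: src => // x xi.
by have := c x xi; rewrite mem_cat negb_or => /andP[].
Qed.
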